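(* Let $n\ge 1$ and consider $\mathbb{C}^d=(\mathbb{C}^3)^{\otimes n}$, $d=3^n$. Up to local equivalence transformations there exists a unique quadruple of pairwise mutually unbiased product bases, namely $$\mathcal{B}_0=\{|J_z^1\rangle\otimes\cdots\otimes|J_z^n\rangle\},\quad \mathcal{B}_1=\{|J_x^1\rangle\otimes\cdots\otimes|J_x^n\rangle\},$$ $$\mathcal{B}_2=\{|J_y^1\rangle\otimes\cdots\otimes|J_y^n\rangle\},\quad \mathcal{B}_3=\{|J_w^1\rangle\otimes\cdots\otimes|J_w^n\rangle\},$$ where, for each $r=1,\ldots,n$, the sets $\{|J_b^r\rangle : J=0,1,2\}$ with $b=z,x,y,w$ are the orthonormal eigenbases of $Z$, $X$, $XZ$ and $XZ^2$, respectively, on the $r$-th factor $\mathbb{C}^3$, and in each $\mathcal{B}_i$ the labels $J^1,\ldots,J^n\in\{0,1,2\}$ of the different factors vary independently.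
   Context: $X$ and $Z$ are the Heisenberg-Weyl shift and phase operators on $\mathbb{C}^3$: $X|j\rangle=|j+1 \bmod 3\rangle$, $Z|j\rangle=\omega^j|j\rangle$, $\omega=e^{2\pi i/3}$, so that $ZX=\omega XZ$. A product basis of $\mathbb{C}^{d_1}\otimes\cdots\otimes\mathbb{C}^{d_n}$ is an orthonormal basis each of whose vectors is a tensor product $|\psi^1\rangle\otimes\cdots\otimes|\psi^n\rangle$ with $|\psi^r\rangle\in\mathbb{C}^{d_r}$. It need not be a tensor product of bases of the factors. Two orthonormal bases $\{|a_i\rangle\}$, $\{|b_j\rangle\}$ of $\mathbb{C}^d$ are mutually unbiased if $|\langle a_i|b_j\rangle|^2=1/d$ for all $i,j$. Two sets of product bases are equivalent (under local equivalence transformations) if one is obtained from the other by a composition of the following: a local unitary $U_1\otimes\cdots\otimes U_n$ ($U_r$ unitary on $\mathbb{C}^{d_r}$) applied to all bases simultaneously; multiplication of any basis vector by a phase factor; permutation of the vectors within a basis; local complex conjugation applied to all bases (i.e. for a chosen factor $r$, replacing the $r$-th tensor factor of every vector of every basis by its entrywise complex conjugate in the standard basis); and reordering of the bases. *)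

(* Defs.v *)
From HB Require Import structures.
From mathcomp Require Import all_boot all_order all_algebra perm.
From mathcomp Require Import spectral complex.
From mathcomp Require Import reals trigo.

Set Implicit Arguments.
Unset Strict Implicit.
Unset Printing Implicit Defensive.

Import Order.TTheory GRing.Theory Num.Theory.
Local Open Scope ring_scope.

Section Bases.
Variables (C : numClosedFieldType) (T : finType).

(* Vectors of C^T are given by their coordinates; the inner product is
   antilinear in the first argument. *)
Definition braket (u v : T -> C) : C := \sum_k (u k)^* * v k.

Definition orthonormal_basis (b : T -> T -> C) : Prop :=
  (forall i j, braket (b i) (b j) = (i == j)%:R) /\
  (forall v : T -> C, exists c : T -> C, forall k, v k = \sum_i c i * b i k).

Definition mutually_unbiased (a b : T -> T -> C) : Prop :=
  forall i j, `|braket (a i) (b j)| ^+ 2 = (#|T|%:R)^-1.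

End Bases.

(* A multi-index J = (J^1, ..., J^n) with J^r in {0, ..., q-1}. *)
Notation multi_index n q := {ffun 'I_n -> 'I_q}.

(* (C^q)^(tensor n), in coordinates for the basis |k^1> (x) ... (x) |k^n>;
   its dimension is #|multi_index n q| = q ^ n. *)
Notation tensor_space C n q := {ffun multi_index n q -> C}.

Section ProductBases.
Variables (C : numClosedFieldType) (n q : nat).

Definition tensor (psi : 'I_n -> 'cV[C]_q) : tensor_space C n q :=
  [ffun k : multi_index n q => \prod_(r < n) psi r (k r) 0].

(* U_1 (x) ... (x) U_n applied to a vector. *)
Definition tensor_op (U : 'I_n -> 'M[C]_q) (v : tensor_space C n q) :
    tensor_space C n q :=
  [ffun k : multi_index n q =>
     \sum_(l : multi_index n q) (\prod_(r < n) U r (k r) (l r)) * v l].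

Definition product_basis (B : multi_index n q -> tensor_space C n q) : Prop :=
  orthonormal_basis (fun J => B J : multi_index n q -> C) /\
  (forall J, exists psi : 'I_n -> 'cV[C]_q, B J = tensor psi).

Definition basis_family (m : nat) :=
  'I_m -> multi_index n q -> tensor_space C n q.

Definition mu_product_bases (m : nat) (B : basis_family m) : Prop :=
  (forall a, product_basis (B a)) /\
  (forall a b, a != b ->
     mutually_unbiased (fun J => B a J : multi_index n q -> C)
                       (fun J => B b J : multi_index n q -> C)).

Inductive local_equiv (m : nat) : basis_family m -> basis_family m -> Prop :=
| LE_unitary (B B' : basis_family m) (U : 'I_n -> 'M[C]_q) :
    (forall r, U r \is unitarymx) ->
    (forall a J, B' a J = tensor_op U (B a J)) ->
    local_equiv B B'
| LE_phase (B B' : basis_family m) (c : 'I_m -> multi_index n q -> C) :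
    (forall a J, `|c a J| = 1) ->
    (forall a J k, B' a J k = c a J * B a J k) ->
    local_equiv B B'
| LE_permute_vectors (B B' : basis_family m) (s : 'I_m -> {perm multi_index n q}) :
    (forall a J, B' a J = B a (s a J)) ->
    local_equiv B B'
(* The factors of a nonzero product vector are only determined up to scalars
   of product 1, so the conjugated vector is determined up to a phase. *)
| LE_conj (B B' : basis_family m) (r : 'I_n) (psi : 'I_m -> multi_index n q -> 'I_n -> 'cV[C]_q) :
    (forall a J, B a J = tensor (psi a J)) ->
    (forall a J, B' a J = tensor (fun s =>
       if s == r then map_mx Num.conj (psi a J s) else psi a J s)) ->
    local_equiv B B'
| LE_permute_bases (B B' : basis_family m) (s : {perm 'I_m}) :
    (forall a J, B' a J = B (s a) J) ->
    local_equiv B B'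
| LE_trans (B1 B2 B3 : basis_family m) :
    local_equiv B1 B2 -> local_equiv B2 B3 -> local_equiv B1 B3.

Definition eigenbasis (A : 'M[C]_q) (e : 'I_q -> 'cV[C]_q) : Prop :=
  orthonormal_basis (fun J k => e J k 0) /\
  (forall J, exists lambda : C, A *m e J = lambda *: e J).

(* The family {|J^1> (x) ... (x) |J^n>}, where e r J = |J> in the factor r. *)
Definition tensor_basis (e : 'I_n -> 'I_q -> 'cV[C]_q) :
    multi_index n q -> tensor_space C n q :=
  fun J => tensor (fun r => e r (J r)).

End ProductBases.

Section HeisenbergWeyl.
Variable R : realType.

(* exp(2 pi i / 3) *)
Definition omega : R[i] := Complex (cos (2 * pi / 3)) (sin (2 * pi / 3)).

(* ordS is the cyclic successor, so the column j of shiftX is |j+1 mod 3>. *)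
Definition shiftX : 'M[R[i]]_3 := \matrix_(i, j) (i == ordS j)%:R.

Definition phaseZ : 'M[R[i]]_3 := \matrix_(i, j) (omega ^+ j *+ (i == j)).

Definition weyl (b : 'I_4) : 'M[R[i]]_3 :=
  nth 0 [:: phaseZ; shiftX; shiftX *m phaseZ; shiftX *m phaseZ *m phaseZ] b.

End HeisenbergWeyl.

(* Main.v *)
(* Unbiasedness of product bases passes to the factors: if x_J and y_J are the
   squared overlaps in the factor r and in the other factors, then x_J y_J = 3^-n,
   while the partial traces of the resolution of the identity give
   sum x_J = 3^(n-1) and sum y_J = 3, so that the equality case of AM-GM makes
   x_J constant.  Hence in each factor C^3 there are four spanning sets of unit
   vectors, pairwise unbiased across different sets.  The traceless parts of
   their projectors span pairwise orthogonal subspaces of the 8-dimensional space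
   of traceless matrices, each of dimension at least 2, hence exactly 2; this
   forces each set to be an orthonormal basis, up to phases.  So there are four
   mutually unbiased bases in each factor, and a unitary sends the first one to
   the eigenbasis of Z and the second one to that of X.  A vector unbiased to
   both is a multiple of (1, a, w a^2) or (1, a, w^2 a^2) with a^3 = 1, that is,
   an eigenvector of XZ or XZ^2, and complex conjugation exchanges the two. *)
Require Import Defs.
From mathcomp Require Import all_boot all_order all_algebra perm.
From mathcomp Require Import spectral complex.
From mathcomp Require Import reals trigo.
From mathcomp Require Import ring lra.

Set Implicit Arguments.
Unset Strict Implicit.
Unset Printing Implicit Defensive.

Import Order.TTheory GRing.Theory Num.Theory.
Local Open Scope ring_scope.
Local Open Scope sesquilinear_scope.

(** * Inner products and finite bases *)

Section Dot.
Variables (C : numClosedFieldType) (q : nat).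
Implicit Types u v w : 'cV[C]_q.

Definition dot u v : C := braket (fun k => u k 0) (fun k => v k 0).

Lemma dotE u v : dot u v = \sum_k (u k 0)^* * v k 0.
Proof. by []. Qed.

Lemma dotC u v : (dot u v)^* = dot v u.
Proof.
rewrite !dotE rmorph_sum; apply: eq_bigr => k _.
by rewrite rmorphM /= conjCK mulrC.
Qed.

Lemma dotZr a u v : dot u (a *: v) = a * dot u v.
Proof. by rewrite !dotE mulr_sumr; apply: eq_bigr => k _; rewrite mxE mulrCA. Qed.

Lemma dotZl a u v : dot (a *: u) v = a^* * dot u v.
Proof. by rewrite -dotC dotZr rmorphM /= dotC. Qed.

Lemma dotDr u v w : dot u (v + w) = dot u v + dot u w.
Proof.
by rewrite !dotE -big_split; apply: eq_bigr => k _; rewrite mxE mulrDr.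
Qed.

Lemma dot0r u : dot u 0 = 0.
Proof. by rewrite -(scale0r 0) dotZr mul0r. Qed.

Lemma dot_sumr (I : finType) u (v : I -> 'cV[C]_q) :
  dot u (\sum_i v i) = \sum_i dot u (v i).
Proof.
apply: (big_ind2 (fun x y => dot u x = y)) => [|x _ y _ <- <-|//].
  exact: dot0r.
exact: dotDr.
Qed.

Lemma norm_dotC u v : `|dot u v| = `|dot v u|.
Proof. by rewrite -dotC norm_conjC. Qed.

Lemma dot_delta k v : dot (delta_mx k 0) v = v k 0.
Proof.
rewrite dotE (bigD1 k) //= big1 => [|i /negPf ik]; rewrite !mxE.
  by rewrite !eqxx conjC1 mul1r addr0.
by rewrite ik conjC0 mul0r.
Qed.

Lemma dot_ge0 u : 0 <= dot u u.
Proof. by apply: sumr_ge0 => k _; rewrite mulrC mul_conjC_ge0. Qed.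

Lemma dot_eq0 u : dot u u = 0 -> u = 0.
Proof.
move=> /psumr_eq0P uu0; apply/colP => k; rewrite mxE; apply/eqP.
rewrite -mul_conjC_eq0 mulrC uu0 // => i _.
by rewrite mulrC mul_conjC_ge0.
Qed.

Lemma dot_mulmx (U : 'M[C]_q) u v : dot (U ^t* *m u) v = dot u (U *m v).
Proof.
rewrite !dotE; under eq_bigr => k _ do rewrite mxE rmorph_sum mulr_suml.
rewrite exchange_big; apply: eq_bigr => k _.
rewrite mxE mulr_sumr; apply: eq_bigr => i _.
by rewrite !mxE rmorphM /= conjCK; ring.
Qed.

Lemma dot_unitary (U : 'M[C]_q) u v :
  U \is unitarymx -> dot (U *m u) (U *m v) = dot u v.
Proof.
move=> /unitarymxP/mulmx1C UU.
by rewrite -dot_mulmx mulmxA UU mul1mx.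
Qed.

Lemma dot_conj u v : dot (map_mx Num.conj u) (map_mx Num.conj v) = (dot u v)^*.
Proof.
rewrite !dotE rmorph_sum; apply: eq_bigr => k _.
by rewrite !mxE rmorphM.
Qed.

End Dot.

Section FiniteBases.
Variables (C : numClosedFieldType) (T : finType).
Implicit Types (b : T -> T -> C).

(** Orthonormality gives a square matrix a one-sided inverse, which is then two-sided; the product
    in the other order is the resolution of the identity. *)
Lemma completeness b : (forall i j, braket (b i) (b j) = (i == j)%:R) ->
  forall k l, \sum_i b i k * (b i l)^* = (k == l)%:R.
Proof.
move=> on k l.
pose M : 'M[C]_#|T| := \matrix_(i, j) (b (enum_val i) (enum_val j))^*.
have /mulmx1C MM : M *m M ^t* = 1%:M.
  apply/matrixP => i j; rewrite !mxE -(inj_eq enum_val_inj) -on /braket.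
  rewrite (reindex _ (onW_bij _ (enum_val_bij T))).
  by apply: eq_bigr => m _; rewrite !mxE conjCK.
have := congr1 (fun A : 'M_#|T| => A (enum_rank k) (enum_rank l)) MM.
rewrite !mxE (inj_eq enum_rank_inj) => <-.
rewrite (reindex _ (onW_bij _ (enum_val_bij T))).
by apply: eq_bigr => m _; rewrite !mxE !enum_rankK conjCK.
Qed.

Lemma expansion b (v : T -> C) : (forall i j, braket (b i) (b j) = (i == j)%:R) ->
  forall k, v k = \sum_i braket (b i) v * b i k.
Proof.
move=> on k; under eq_bigr => i _ do rewrite mulr_suml.
rewrite exchange_big /= (bigD1 k) //= [X in _ + X]big1 ?addr0 => [|l /negPf lk].
  under eq_bigr => i _ do rewrite mulrAC [_^* * _]mulrC.
  by rewrite -mulr_suml completeness // eqxx mul1r.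
under eq_bigr => i _ do rewrite mulrAC [_^* * _]mulrC.
by rewrite -mulr_suml completeness // eq_sym lk mul0r.
Qed.

Lemma orthonormal_basisP b :
  (forall i j, braket (b i) (b j) = (i == j)%:R) -> orthonormal_basis b.
Proof.
by move=> on; split=> // v; exists (fun i => braket (b i) v); apply: expansion.
Qed.

Lemma parseval b (v : T -> C) : (forall i j, braket (b i) (b j) = (i == j)%:R) ->
  \sum_i `|braket (b i) v| ^+ 2 = braket v v.
Proof.
move=> on; rewrite [RHS]/braket.
under [RHS]eq_bigr => k _ do rewrite {2}(expansion v on k) mulr_sumr.
rewrite exchange_big; apply: eq_bigr => i _ /=.
rewrite normCK [in X in _ * X]/braket rmorph_sum mulr_sumr.
by apply: eq_bigr => k _; rewrite rmorphM /= conjCK; ring.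
Qed.

End FiniteBases.

(** * Product bases and their factors *)

Section Tensor.
Variables (C : numClosedFieldType) (n q : nat).
Implicit Types (phi psi : 'I_n -> 'cV[C]_q).

Lemma braket_tensor psi phi :
  braket (tensor psi) (tensor phi) = \prod_r dot (psi r) (phi r).
Proof.
rewrite bigA_distr_bigA; apply: eq_bigr => k _.
by rewrite !ffunE rmorph_prod -big_split.
Qed.

Lemma eq_tensor psi phi : psi =1 phi -> tensor psi = tensor phi.
Proof. by move=> E; apply/ffunP => k; rewrite !ffunE; apply: eq_bigr => r _; rewrite E. Qed.

Lemma tensorZ (c : 'I_n -> C) psi k :
  tensor (fun r => c r *: psi r) k = (\prod_r c r) * tensor psi k.
Proof. by rewrite !ffunE -big_split; apply: eq_bigr => r _; rewrite mxE. Qed.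

Lemma tensor_op_tensor (U : 'I_n -> 'M[C]_q) psi :
  tensor_op U (tensor psi) = tensor (fun r => U r *m psi r).
Proof.
apply/ffunP => k; rewrite !ffunE; under [RHS]eq_bigr => r _ do rewrite mxE.
rewrite bigA_distr_bigA; apply: eq_bigr => l _.
by rewrite ffunE -big_split.
Qed.

(** Each factor is divided by its norm. The product of the norms is nonnegative with square 1, hence
    equal to 1, so the tensor does not change. *)
Lemma unit_factors psi : \prod_r dot (psi r) (psi r) = 1 ->
  exists phi, tensor psi = tensor phi /\ forall r, dot (phi r) (phi r) = 1.
Proof.
move=> n1; pose N r := sqrtC (dot (psi r) (psi r)).
have NN r : N r ^+ 2 = dot (psi r) (psi r) by rewrite sqrtCK.
have N0 r : N r != 0.
  rewrite -sqrf_eq0 NN; apply/eqP => E.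
  by move: n1; rewrite (bigD1 r) //= E mul0r => /esym/eqP; rewrite oner_eq0.
have Nge r : 0 <= N r by rewrite sqrtC_ge0 dot_ge0.
exists (fun r => (N r)^-1 *: psi r); split=> [|r].
  apply/ffunP => k; rewrite (tensorZ (fun r => (N r)^-1)) prodfV.
  suff -> : \prod_r N r = 1 by rewrite invr1 mul1r.
  have ge0 : 0 <= \prod_r N r by apply: prodr_ge0.
  apply/eqP; rewrite -(@eqrXn2 _ 2) ?ler01 //.
  by rewrite expr1n -prodrXl; under eq_bigr do rewrite NN; apply/eqP.
rewrite dotZl dotZr -NN conj_Creal; last by rewrite rpredV ger0_real.
by rewrite mulrA -expr2 -exprMn mulVf // expr1n.
Qed.

End Tensor.

Section ProductBasisFactors.
Variables (C : numClosedFieldType) (n q : nat).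
Notation T := (multi_index n q.+1).
Implicit Types (psi : T -> 'I_n -> 'cV[C]_q.+1).

Definition factors (B : T -> tensor_space C n q.+1) psi :=
  (forall J, B J = tensor (psi J)) /\ (forall J r, dot (psi J r) (psi J r) = 1).

Lemma product_basis_factors (B : T -> tensor_space C n q.+1) :
  product_basis B -> exists psi, factors B psi.
Proof.
case=> [[on _] prodB].
suff /fin_all_exists [psi /all_and2 psiP] : forall J, exists phi,
    B J = tensor phi /\ forall r, dot (phi r) (phi r) = 1 by exists psi.
move=> J; have [phi E] := prodB J.
have := on J J; rewrite E braket_tensor eqxx => /unit_factors[phi' [E' u]].
by exists phi'; rewrite E'.
Qed.

(* Parseval for product vectors whose factors outside [P] run over the
   standard basis: the partial trace of the resolution of the identity. *)
Lemma partial_parseval (B : T -> tensor_space C n q.+1) psi mu (P : pred 'I_n) :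
  (forall J K, braket (B J) (B K) = (J == K)%:R) -> factors B psi ->
  (forall r, dot (mu r) (mu r) = 1) ->
  \sum_J \prod_(r | P r) `|dot (psi J r) (mu r)| ^+ 2 =
  q.+1%:R ^+ #|[predC P]|.
Proof.
move=> on [E psi1] mu1.
(* Outside [P] the index runs over the standard basis, whose squared overlaps with a unit factor sum
   to 1. Inside [P] only [ord0] carries [mu r] and the other indices are padded with 0, so a single
   sum over multi-indices covers both kinds of factor. *)
pose nu r (j : 'I_q.+1) : 'cV[C]_q.+1 := 
  if P r then (if j == ord0 then mu r else 0) else delta_mx j 0.
have nuE J : \prod_(r | P r) `|dot (psi J r) (mu r)| ^+ 2 =
    \prod_r \sum_j `|dot (psi J r) (nu r j)| ^+ 2.
  rewrite big_mkcond; apply: eq_bigr => r _; rewrite /nu; case: (P r).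
    rewrite (bigD1 ord0) //= big1 ?addr0 // => j /negPf ->.
    by rewrite dot0r normr0 expr0n.
  under eq_bigr => j _ do rewrite norm_dotC dot_delta normCKC.
  by rewrite -dotE psi1.
under eq_bigr => J _ do rewrite nuE bigA_distr_bigA.
rewrite exchange_big /=.
transitivity (\sum_(k : T) \prod_r dot (nu r (k r)) (nu r (k r))).
  apply: eq_bigr => k _; rewrite -braket_tensor -(parseval _ on).
  by apply: eq_bigr => J _; rewrite E braket_tensor normr_prod -prodrXl.
rewrite -(bigA_distr_bigA (fun r j => dot (nu r j) (nu r j))) /=.
rewrite (bigID P) /= big1 ?mul1r => [|r Pr].
  transitivity (\prod_(r < n | ~~ P r) q.+1%:R : C); last first.
    by rewrite prodr_const.
  apply: eq_bigr => r /negPf Pr; under eq_bigr => j _.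
    by rewrite /nu Pr dot_delta mxE !eqxx; over.
  by rewrite sumr_const card_ord.
rewrite (bigD1 ord0) //= big1 /nu ?Pr ?mu1 ?addr0 // => j /negPf ->.
exact: dot0r.
Qed.

(** Multiplied by [x i > 0], a summand becomes [(x i - 1) ^+ 2]. All summands are thus nonnegative,
    and the zero sum makes each of them vanish. *)
Lemma amgm_eq1 (I : finType) (x y : I -> C) :
  (forall i, 0 <= x i) -> (forall i, x i * y i = 1) ->
  \sum_i (x i + y i - 2) = 0 -> forall i, x i = 1.
Proof.
move=> x_ge0 xy1 /psumr_eq0P s0 i.
have x0 j : x j != 0.
  by apply/eqP => xj; move: (xy1 j); rewrite xj mul0r => /esym/eqP; rewrite oner_eq0.
have E j : x j * (x j + y j - 2) = (x j - 1) ^+ 2.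
  by rewrite mulrBr mulrDr xy1; ring.
have {}s0 : x i + y i - 2 = 0.
  apply: s0 => // j _; have xgt0 : 0 < x j by rewrite lt0r x0 x_ge0.
  rewrite -(pmulr_rge0 _ xgt0) E real_exprn_even_ge0 //.
  by rewrite rpredB ?real1 // ger0_real.
by apply/eqP; rewrite -subr_eq0 -sqrf_eq0 -E s0 mulr0.
Qed.

Lemma unbiased_factors (B B' : T -> tensor_space C n q.+1) psi psi' :
  product_basis B -> factors B psi -> factors B' psi' ->
  mutually_unbiased (fun J => B J : T -> C) (fun J => B' J : T -> C) ->
  forall J K r, `|dot (psi J r) (psi' K r)| ^+ 2 = q.+1%:R^-1.
Proof.
move=> [[on _] _] fB [E' psi'1] mu J K r.
have q0 : (q.+1%:R : C) != 0 by rewrite pnatr_eq0.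
(* The existence of [r] gives [n > 0], so [n.-1] really counts the other factors. *)
have cT : #|T| = (q.+1 * q.+1 ^ n.-1)%N.
  by rewrite card_ffun !card_ord -expnS prednK // (leq_trans _ (ltn_ord r)).
pose x L := \prod_(s | s == r) `|dot (psi L s) (psi' K s)| ^+ 2.
pose y L := \prod_(s | s != r) `|dot (psi L s) (psi' K s)| ^+ 2.
have xy L : x L * y L = (#|T|%:R)^-1.
  by rewrite /x /y -(bigID (pred1 r) xpredT) -(mu L K) fB.1 E' braket_tensor
    normr_prod -prodrXl.
have sx : \sum_L x L = q.+1%:R ^+ n.-1.
  by rewrite /x (partial_parseval _ on fB) //; congr (_ ^+ _); rewrite cardC1 card_ord.
have sy : \sum_L y L = q.+1%:R.
  rewrite /y (partial_parseval _ on fB) // -[RHS]expr1; congr (_ ^+ _).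
  by rewrite -(card1 r); apply: eq_card => s; rewrite !inE negbK.
(* The rescaling makes every product 1 and both sums equal to the number of labels. *)
have := @amgm_eq1 T (fun L => q.+1%:R * x L) (fun L => q.+1%:R ^+ n.-1 * y L).
move=> /(_ _ _ _ J) H; have := H _; rewrite /x big_pred1_eq => {}H.
apply: (mulfI q0); rewrite H ?mulfV // => [L|L|].
- by rewrite mulr_ge0 ?ler0n // prodr_ge0 // => s _; rewrite exprn_ge0.
- by rewrite mulrACA xy cT natrM natrX mulfV // mulf_neq0 ?expf_neq0.
rewrite sumrB big_split /= -!mulr_sumr sx sy sumr_const -[#|_|]/#|T| cT.
by rewrite -(mulr_natr 2) natrM natrX; ring.
Qed.

(** The product vector with [w] in the factor [r] and a standard unit vector elsewhere is orthogonal
    to every [B J]; by Parseval its squared norm [dot w w] is 0. *)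
Lemma factors_spanning (B : T -> tensor_space C n q.+1) psi r (w : 'cV[C]_q.+1) :
  product_basis B -> factors B psi ->
  (forall J, dot (psi J r) w = 0) -> w = 0.
Proof.
move=> [[on _] _] [E u] w0; apply: dot_eq0.
pose mu s : 'cV[C]_q.+1 := if s == r then w else delta_mx ord0 0.
have := parseval (tensor mu) on; rewrite braket_tensor (bigD1 r) //=.
rewrite [X in _ * X]big1 ?mulr1 /mu ?eqxx => [<-|s /negPf ->].
  rewrite big1 // => J _; rewrite E braket_tensor (bigD1 r) //= eqxx w0.
  by rewrite mul0r normr0 expr0n.
by rewrite dot_delta mxE !eqxx.
Qed.

End ProductBasisFactors.

(** * Unbiased spanning sets in dimension three *)

Section LinearIndependence.
Variable C : numClosedFieldType.

Lemma linear_dependence (I : finType) n (m : I -> 'rV[C]_n) : (n < #|I|)%N ->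
  exists c : I -> C, (exists i, c i != 0) /\ \sum_i c i *: m i = 0.
Proof.
move=> lt_nI; pose M : 'M_(#|I|, n) := \matrix_i m (enum_val i).
have K0 : kermx M != 0.
  by rewrite -mxrank_eq0 mxrank_ker subn_eq0 -ltnNge (leq_ltn_trans (rank_leq_col M)).
have uM : nz_row (kermx M) *m M = 0 by apply/sub_kermxP/nz_row_sub.
have /rV0Pn [j uj] : nz_row (kermx M) != 0 by rewrite nz_row_eq0.
exists (fun i => nz_row (kermx M) 0 (enum_rank i)); split.
  by exists (enum_val j); rewrite enum_valK.
rewrite -[RHS]uM mulmx_sum_row (reindex _ (onW_bij _ (enum_val_bij I))).
by apply: eq_bigr => i _; rewrite rowK enum_valK.
Qed.

Definition lin_indep q (I : finType) (v : I -> 'cV[C]_q) :=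
  forall x : I -> C, \sum_i x i *: v i = 0 -> forall i, x i = 0.

(** A kernel vector of the transposed matrix with rows [v J] has a conjugate orthogonal to all
    [v J]. The kernel is therefore 0, the matrix has full column rank, and [q] of its rows form an
    invertible matrix. *)
Lemma indep_subfamily q (T : finType) (v : T -> 'cV[C]_q) :
  (forall w, (forall J, dot (v J) w = 0) -> w = 0) ->
  exists t : 'I_q -> T, lin_indep (fun i => v (t i)).
Proof.
move=> span; pose A : 'M_(#|T|, q) := \matrix_(J, k) v (enum_val J) k 0.
have fullA : row_full A.
  rewrite /row_full -mxrank_tr -/(row_free A^T) -kermx_eq0.
  apply/eqP/row_matrixP => i; rewrite row0.
  have : row i (kermx A^T) *m A^T = 0 by apply/sub_kermxP/row_sub.
  set y := row i _ => /rowP yA.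
  have: (map_mx Num.conj y)^T = 0.
    apply: span => J; have := yA (enum_rank J).
    rewrite !mxE dotE => /(congr1 Num.conj); rewrite conjC0 => {2}<-.
    rewrite rmorph_sum; apply: eq_bigr => k _.
    by rewrite rmorphM !mxE enum_rankK mulrC.
  move=> /matrixP y0; apply/rowP => k; rewrite [RHS]mxE.
  by apply/eqP; rewrite -conjC_eq0; have := y0 k 0; rewrite !mxE => ->.
have U := fullrowsub_unit fullA.
exists (fun i => enum_val (fullrankfun fullA i)) => x x0 i.
suff /rowP /(_ i) : \row_k x k = 0 by rewrite !mxE.
apply: (can_inj (mulmxK U)); rewrite mul0mx; apply/rowP => k.
have := congr1 (fun u : 'cV_q => u k 0) x0; rewrite summxE !mxE => E; rewrite -[RHS]E.
by apply: eq_bigr => l _; rewrite !mxE.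
Qed.

(** Equality case of Cauchy-Schwarz: the component of [v] orthogonal to [u] is orthogonal to [v] as
    well, hence to itself. *)
Lemma unit_parallel q (u v : 'cV[C]_q) : dot u u = 1 -> dot v v = 1 ->
  `|dot u v| ^+ 2 = 1 -> v = dot u v *: u.
Proof.
move=> u1 v1 uv; apply/eqP; rewrite -subr_eq0; apply/eqP/dot_eq0.
have uw : dot u (v - dot u v *: u) = 0.
  by rewrite -scaleNr dotDr dotZr u1; ring.
have vw : dot v (v - dot u v *: u) = 0.
  by rewrite -scaleNr dotDr dotZr v1 mulNr -[dot v u]dotC -normCK uv subrr.
set w := v - _ in uw vw *; rewrite {2}/w -scaleNr dotDr dotZr.
by rewrite -[dot _ v]dotC -[dot _ u]dotC uw vw conjC0 mulr0 addr0.
Qed.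

End LinearIndependence.

(** * Dimension count for projectors of unbiased vectors *)

Section UnbiasedSpanningSets.
Variables (C : numClosedFieldType).

(** A linear relation among the identity and the projectors decouples by unbiasedness: the
    coefficients of each nonparallel pair vanish. What remains writes a nonzero multiple of the
    identity through the projectors on the [v i], and independence of the [v i] then makes them
    orthogonal. *)
Lemma unbiased_triple_orthogonal (phi : 'I_3 -> bool -> 'cV[C]_3)
    (v : 'I_3 -> 'cV[C]_3) :
  (forall i, dot (v i) (v i) = 1) ->
  (forall b e, dot (phi b e) (phi b e) = 1) ->
  (forall i b e, `|dot (v i) (phi b e)| ^+ 2 = 3^-1) ->
  (forall b b' e e', b != b' -> `|dot (phi b e) (phi b' e')| ^+ 2 = 3^-1) ->
  (forall b, `|dot (phi b true) (phi b false)| ^+ 2 != 1) ->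
  lin_indep v -> forall i j, i != j -> dot (v i) (v j) = 0.
Proof.
move=> v1 phi1 vphi phiphi nonpar indep i j ij.
have n3 : (3 : C) != 0 by rewrite pnatr_eq0.
pose I : finType := ('I_1 + ('I_3 + 'I_3 * bool))%type.
pose w (x : 'I_3 + 'I_3 * bool) :=
  match x with inl i => v i | inr (b, e) => phi b e end.
have w1 x : dot (w x) (w x) = 1 by case: x => [k|[b e]] /=.
pose m (x : I) : 'M[C]_3 := if x is inr x then w x *m (w x)^t* else 1%:M.
(* The identity and nine projectors: ten elements of the 9-dimensional 'M_3. *)
have [|c [[x0 cx0] dep]] := linear_dependence (fun x : I => mxvec (m x)).
  by rewrite !card_sum card_prod card_bool !card_ord.
have := congr1 vec_mx dep; rewrite linear_sum linear0 /= => sum0.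
have {}sum0 : c (inl ord0) *: 1%:M + \sum_x c (inr x) *: m (inr x) = 0.
  rewrite -[RHS]sum0 [RHS]big_sumType big_ord1 /= linearZ /= mxvecK; congr (_ + _).
  by apply: eq_bigr => x _; rewrite linearZ /= mxvecK.
have mE x u : m (inr x) *m u = dot (w x) u *: w x.
  rewrite /m -mulmxA; apply/colP => k.
  rewrite mxE big_ord1 mxE [RHS]mxE mulrC dotE; congr (_ * _).
  by apply: eq_bigr => l _; rewrite !mxE.
have vec0 u : c (inl ord0) *: u + \sum_x (c (inr x) * dot (w x) u) *: w x = 0.
  have := congr1 (fun A => A *m u) sum0.
  rewrite mul0mx mulmxDl -scalemxAl mul1mx mulmx_suml => E; rewrite -[RHS]E.
  congr (_ + _); apply: eq_bigr => x _.
  by rewrite -scalemxAl mE scalerA.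
(* The trace expresses the coefficient of the identity through the others; in [pair0] this shifts
   every squared overlap by 1/3. *)
have tr0 : 3 * c (inl ord0) + \sum_x c (inr x) = 0.
  have := congr1 mxtrace sum0; rewrite mxtraceD mxtraceZ mxtrace1 mxtrace0.
  rewrite raddf_sum mulrC => E; rewrite -[RHS]E; congr (_ + _).
  apply: eq_bigr => x _; rewrite /= mxtraceZ -[LHS]mulr1 -(w1 x); congr (_ * _).
  rewrite mxtrace_mulC /mxtrace big_ord1 mxE; apply: eq_bigr => k _.
  by rewrite !mxE.
(* Pairing with the traceless part of |u><u| isolates the set containing u. *)
have pair0 u : dot u u = 1 ->
    \sum_x c (inr x) * (`|dot u (w x)| ^+ 2 - 3^-1) = 0.
  move=> u1; have := congr1 (dot u) (vec0 u).
  rewrite dotDr dotZr u1 dot0r dot_sumr => E.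
  under eq_bigr do rewrite mulrBr.
  rewrite sumrB -mulr_suml -[X in X - _](addKr (c (inl ord0))).
  under eq_bigr => x _ do rewrite normCK dotC mulrA mulrAC -dotZr.
  rewrite mulr1 in E; rewrite E addr0.
  have -> : c (inl ord0) = - (3^-1 * \sum_x c (inr x)).
    by apply: (mulfI n3); rewrite mulrN mulVKf //; apply/eqP; rewrite -addr_eq0 tr0.
  by rewrite opprK mulrC subrr.
have pair b e : c (inr (inr (b, e))) * (1 - 3^-1) +
    c (inr (inr (b, ~~ e))) * (`|dot (phi b e) (phi b (~~ e))| ^+ 2 - 3^-1) = 0.
  rewrite -[RHS](pair0 (phi b e)) // big_sumType /= big1 ?add0r; last first.
    by move=> k _; rewrite norm_dotC vphi subrr mulr0.
  rewrite (bigD1 (b, e)) // (bigD1 (b, ~~ e)) /=; last first.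
    by rewrite xpair_eqE; case: e; rewrite andbF.
  rewrite big1 ?addr0 /w => [|[b' e'] /andP[]].
    by rewrite phi1 normr1 expr1n.
  rewrite !xpair_eqE; have [->|bb'] := eqVneq b' b; first by case: e e' => -[].
  by rewrite phiphi 1?eq_sym // subrr mulr0.
have cphi b e : c (inr (inr (b, e))) = 0.
  have {}nonpar : `|dot (phi b e) (phi b (~~ e))| ^+ 2 != 1.
    by case: e; rewrite // norm_dotC.
  have := pair b (~~ e); rewrite negbK norm_dotC; have := pair b e.
  move: nonpar; set t := `|_| ^+ 2; set x := c _; set y := c _ => t1 xy yx.
  have t0 : 0 <= t by rewrite exprn_ge0.
  (* The factor of [x] is the determinant of the two equations, a difference of squares; it is
     nonzero because [t] is nonnegative and not 1. *)
  have : x * ((1 - t) * (3^-1 + t)) = 0.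
    transitivity ((x * (1 - 3^-1) + y * (t - 3^-1)) * (1 - 3^-1)
      - (y * (1 - 3^-1) + x * (t - 3^-1)) * (t - 3^-1)); first by field.
    by rewrite xy yx !mul0r subrr.
  have s0 : 3^-1 + t != 0 by rewrite gt_eqF // ltr_wpDr // invr_gt0 ltr0n.
  move=> /eqP; rewrite !mulf_eq0 subr_eq0 (eq_sym 1) (negPf t1) (negPf s0).
  by rewrite !orbF => /eqP.
have sum_v u : \sum_i (c (inr (inl i)) * dot (v i) u) *: v i = - (c (inl ord0) *: u).
  apply/eqP; rewrite -addr_eq0 addrC -[X in _ == X](vec0 u) big_sumType /=.
  rewrite [X in _ == _ + (_ + X)]big1 ?addr0 // => -[b e] _.
  by rewrite cphi mul0r scale0r.
(* The remaining relation is applied to [v k], and coefficients are compared in the independent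
   family [v]. *)
have cv k : c (inr (inl k)) = - c (inl ord0) /\
    (forall l, l != k -> c (inr (inl l)) * dot (v l) (v k) = 0).
  pose x l := c (inr (inl l)) * dot (v l) (v k) + (l == k)%:R * c (inl ord0).
  have x0' : forall l, x l = 0.
    apply: indep; under eq_bigr do rewrite scalerDl.
    rewrite big_split /= sum_v (bigD1 k) //= eqxx mul1r big1 ?addr0 ?addNr //.
    by move=> l /negPf ->; rewrite mul0r scale0r.
  split=> [|l /negPf lk]; last by have := x0' l; rewrite /x lk mul0r addr0.
  have := x0' k; rewrite /x v1 eqxx mulr1 mul1r => /eqP.
  by rewrite addr_eq0 => /eqP.
(* Were the coefficient of the identity 0, the whole relation would be trivial. *)
have cN : c (inl ord0) != 0.
  apply: contraNneq cx0 => cN; case: x0 => [k|[k|[b e]]]; rewrite ?ord1 ?cN ?cphi //.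
  by rewrite (cv k).1 cN oppr0.
have /eqP := (cv j).2 i ij; rewrite mulf_eq0 (cv i).1 oppr_eq0 (negPf cN).
by move/eqP.
Qed.

End UnbiasedSpanningSets.

Section Triples.
Variables (C : numClosedFieldType).
Variables (T : finType) (phi : 'I_4 -> T -> 'cV[C]_3).
Hypothesis phi1 : forall a J, dot (phi a J) (phi a J) = 1.
Hypothesis unbiased :
  forall a b J K, a != b -> `|dot (phi a J) (phi b K)| ^+ 2 = 3^-1.
Hypothesis spanning :
  forall a w, (forall J, dot (phi a J) w = 0) -> w = 0.

(** Each of the three other sets, enumerated by [lift a], contains an independent triple; its first
    and last members are the nonparallel pair that the dimension count needs. *)
Lemma orthogonal_of_indep a (s : 'I_3 -> T) :
  lin_indep (fun i => phi a (s i)) ->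
  forall i j, i != j -> dot (phi a (s i)) (phi a (s j)) = 0.
Proof.
have /fin_all_exists [t tP] b := indep_subfamily (@spanning b).
pose u (b : 'I_3) (e : bool) :=
  phi (lift a b) (t (lift a b) (if e then ord0 else ord_max)).
move=> indep; apply: (@unbiased_triple_orthogonal _ u) => //.
- by move=> b e; apply: phi1.
- by move=> i b e; rewrite unbiased // neq_lift.
- by move=> b b' e e' bb'; rewrite unbiased // (inj_eq lift_inj).
move=> b; apply/eqP => uv.
have par := unit_parallel (phi1 _ _) (phi1 _ _) uv.
(* Parallel vectors would give this nontrivial relation in the independent triple. *)
pose x (i : 'I_3) : C :=
  if i == ord0 then dot (u b true) (u b false) else - (i == ord_max)%:R.
have x0 : forall i, x i = 0.
  apply: (tP (lift a b)); rewrite !big_ord_recl big_ord0 /x /=.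
  rewrite -par oppr0 scale0r add0r addr0 scaleN1r /u.
  by rewrite (_ : lift ord0 _ = ord_max) ?subrr //; apply/val_inj.
by have /eqP := x0 ord_max; rewrite /x /= oppr_eq0 oner_eq0.
Qed.

(** Exchange argument: a vector of the set with a nonzero component along [t i] can replace it
    without losing independence. The new triple is again orthogonal, so the other components of that
    vector are 0. *)
Lemma orthonormal_triple a : exists t : 'I_3 -> T,
  (forall i j, dot (phi a (t i)) (phi a (t j)) = (i == j)%:R) /\
  (forall J, exists i c, phi a J = c *: phi a (t i)).
Proof.
have [t tP] := indep_subfamily (@spanning a).
have on i j : dot (phi a (t i)) (phi a (t j)) = (i == j)%:R.
  by have [->|/(orthogonal_of_indep tP)->] := eqVneq i j; rewrite ?phi1.
exists t; split=> // J.
have expJ : phi a J = \sum_i dot (phi a (t i)) (phi a J) *: phi a (t i).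
  apply/colP => k; rewrite summxE.
  rewrite (expansion (fun k => phi a J k 0) on k).
  by apply: eq_bigr => i _; rewrite mxE.
have [i i0] : exists i, dot (phi a (t i)) (phi a J) != 0.
  apply/existsP; apply: contraT => /existsPn all0.
  have := phi1 a J; rewrite {2}expJ big1 => [|i _].
    by rewrite dot0r => /esym/eqP; rewrite oner_eq0.
  by have := all0 i; rewrite negbK => /eqP->; rewrite scale0r.
exists i, (dot (phi a (t i)) (phi a J)).
pose s k := if k == i then J else t k.
have indep : lin_indep (fun k => phi a (s k)).
  move=> x /= sum0.
  have pair k : x i * dot (phi a (t k)) (phi a J) + (k != i)%:R * x k = 0.
    have := congr1 (dot (phi a (t k))) sum0; rewrite dot0r dot_sumr => E.
    rewrite -[RHS]E (bigD1 i) //= dotZr /s eqxx; congr (_ + _).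
    have [->|ki] := eqVneq k i.
      rewrite mul0r big1 // => l li.
      by rewrite (negPf li) dotZr on eq_sym (negPf li) mulr0.
    rewrite (bigD1 k) //= (negPf ki) dotZr on eqxx mulr1 mul1r.
    rewrite big1 ?addr0 // => l /andP[li lk].
    by rewrite (negPf li) dotZr on eq_sym (negPf lk) mulr0.
  have xi0 : x i = 0.
    have /eqP := pair i; rewrite eqxx mul0r addr0 mulf_eq0 (negPf i0) orbF.
    by move/eqP.
  move=> k; have [->//|ki] := eqVneq k i.
  by have := pair k; rewrite xi0 mul0r add0r ki mul1r.
rewrite {1}expJ (bigD1 i) //= big1 ?addr0 // => k ki.
have := orthogonal_of_indep indep ki; rewrite /s eqxx (negPf ki) => ->.
by rewrite scale0r.
Qed.

End Triples.

(** * The four standard bases *)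

Local Notation i0 := (@Ordinal 3 0 isT).
Local Notation i1 := (@Ordinal 3 1 isT).
Local Notation i2 := (@Ordinal 3 2 isT).

Section Standard.
Variables (C : numClosedFieldType) (w : C).
Hypothesis w_sum : 1 + w + w ^+ 2 = 0.

Lemma forall_ord3 (P : 'I_3 -> Prop) : P i0 -> P i1 -> P i2 -> forall i, P i.
Proof.
move=> P0 P1 P2 [] [|[|[|//]]] lt3; [move: P0|move: P1|move: P2];
by congr P; apply: val_inj.
Qed.

Lemma sum_ord3 (F : 'I_3 -> C) : \sum_i F i = F i0 + F i1 + F i2.
Proof.
rewrite !big_ord_recl big_ord0 addr0 addrA.
by congr (_ + _ + _); congr F; apply: val_inj.
Qed.

Lemma dot3 (u v : 'cV[C]_3) : dot u v =
  (u i0 0)^* * v i0 0 + (u i1 0)^* * v i1 0 + (u i2 0)^* * v i2 0.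
Proof. by rewrite dotE sum_ord3. Qed.

Lemma w_cube : w ^+ 3 = 1.
Proof. by apply/eqP; rewrite -subr_eq0 -[0](mulr0 (w - 1)) -w_sum; apply/eqP; ring. Qed.

Lemma w_neq1 : w != 1.
Proof.
apply/eqP => w1; have /eqP : (3 : C) = 0 by rewrite -w_sum w1; ring.
by rewrite pnatr_eq0.
Qed.

Lemma cube_root_conj (a : C) : a ^+ 3 = 1 -> a^* = a ^+ 2.
Proof.
move=> a3; have a0 : a != 0.
  by apply/eqP => a0; move: a3; rewrite a0 expr0n => /esym/eqP; rewrite oner_eq0.
have na : `|a| = 1.
  by apply/eqP; rewrite -(@pexpr_eq1 _ _ 3) // -normrX a3 normr1.
by apply: (mulfI a0); rewrite -normCK na expr1n -exprS a3.
Qed.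

Lemma cube_rootP (a : C) : a ^+ 3 = 1 -> exists j : 'I_3, a = w ^+ j.
Proof.
move=> a3.
have : (a - 1) * ((a - w) * (a - w ^+ 2)) = 0.
  transitivity (a ^+ 3 - w ^+ 3 + (1 + w + w ^+ 2) * (w * a - a ^+ 2)); first by ring.
  by rewrite a3 w_cube w_sum mul0r subrr addr0.
move=> /eqP; rewrite !mulf_eq0 !subr_eq0 => /or3P[] /eqP ->.
- by exists i0.
- by exists i1.
- by exists i2.
Qed.

Lemma cube_root_sum (a : C) : a ^+ 3 = 1 -> a != 1 -> 1 + a + a ^+ 2 = 0.
Proof.
move=> a3; rewrite -subr_eq0 => a1; apply: (mulfI a1).
by rewrite mulr0 -[RHS](subrr (1 : C)) -{3}a3; ring.
Qed.

Lemma w_exp_cube i : (w ^+ i) ^+ 3 = 1.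
Proof. by rewrite exprAC w_cube expr1n. Qed.

Lemma ratio_cube i j : ((w ^+ i)^* * w ^+ j) ^+ 3 = 1.
Proof. by rewrite exprMn -rmorphXn /= !w_exp_cube conjC1 mulr1. Qed.

Lemma w_exp_inj i j : (i < 3)%N -> (j < 3)%N -> w ^+ i = w ^+ j -> i = j.
Proof.
have w2 : w ^+ 2 != 1.
  by apply: contraNneq w_neq1 => w2; rewrite -w_cube exprS w2 mulr1.
have w21 : w ^+ 2 != w.
  apply: contraNneq w_neq1 => w2w.
  by rewrite -w_cube exprS w2w -expr2 w2w.
move: i j => [|[|[|//]]] [|[|[|//]]] _ _ //; rewrite ?expr0 ?expr1 => /eqP;
  by rewrite 1?eq_sym ?(negPf w_neq1) ?(negPf w2) ?(negPf w21) // eq_sym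
     ?(negPf w_neq1) ?(negPf w2) ?(negPf w21).
Qed.

Lemma ratio_sum i j : (i < 3)%N -> (j < 3)%N -> i != j ->
  let m := (w ^+ i)^* * w ^+ j in 1 + m + m ^+ 2 = 0.
Proof.
move=> i3 j3 ij m; apply: cube_root_sum; first exact: ratio_cube.
apply: contraNneq ij => m1; apply/eqP/w_exp_inj => //.
rewrite -[LHS]mulr1 -m1 /m mulrA cube_root_conj ?w_exp_cube //.
by rewrite -exprS w_exp_cube mul1r.
Qed.

(* For [b] nonzero: the vectors (1, a, w^(b-1) a^2), up to scalars. *)
Definition mub_vec (b : nat) (v : 'cV[C]_3) : Prop :=
  if b == 0 then exists j, forall k, k != j -> v k 0 = 0
  else exists a, [/\ a ^+ 3 = 1, v i1 0 = a * v i0 0 &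
                     v i2 0 = w ^+ b.-1 * a ^+ 2 * v i0 0].

(** As [k./2] is 1 only for [k = 2], the entries are [1], [a], [w ^+ b.-1 * a ^+ 2] with
    [a = w ^+ j]. *)
Definition std (b : nat) (j : 'I_3) : 'cV[C]_3 :=
  if b == 0 then delta_mx j 0
  else (sqrtC 3)^-1 *: \col_k w ^+ (j * k + b.-1 * k./2).

Lemma sqrt3_norm (x : C) : `|(sqrtC 3)^-1 * x| ^+ 2 = 3^-1 * `|x| ^+ 2.
Proof.
rewrite normrM exprMn; congr (_ * _).
by rewrite normfV exprVn ger0_norm ?sqrtC_ge0 ?ler0n // sqrtCK.
Qed.

Lemma mub_vecZ b c v : mub_vec b v -> mub_vec b (c *: v).
Proof.
rewrite /mub_vec; case: (b == 0) => [[j v0]|[a [a3 v1 v2]]].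
  by exists j => k /v0; rewrite mxE => ->; rewrite mulr0.
by exists a; split=> //; rewrite !mxE ?v1 ?v2; ring.
Qed.

Lemma mub_std b j : mub_vec b (std b j).
Proof.
rewrite /mub_vec /std; case: (b == 0).
  by exists j => k /negPf kj; rewrite mxE kj.
exists (w ^+ j); split; first exact: w_exp_cube.
  by rewrite !mxE /= !muln0 !muln1 addn0 expr0 mulr1 mulrC.
rewrite !mxE /= !muln0 !muln1 addn0 expr0 mulr1 exprD exprM.
by rewrite mulrC [X in X * _]mulrC.
Qed.

Lemma mub_entry b v k : b != 0 -> dot v v = 1 -> mub_vec b v ->
  `|v k 0| ^+ 2 = 3^-1.
Proof.
rewrite /mub_vec => /negPf -> v1 [a [a3 va vb]].
have n1 x : x ^+ 3 = 1 -> `|x| ^+ 2 = 1 :> C.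
  by move=> x3; rewrite normCK cube_root_conj // -exprS.
have e1 : `|v i1 0| ^+ 2 = `|v i0 0| ^+ 2 by rewrite va normrM exprMn n1 ?mul1r.
have e2 : `|v i2 0| ^+ 2 = `|v i0 0| ^+ 2.
  by rewrite vb normrM exprMn n1 ?mul1r // exprMn w_exp_cube exprAC a3 expr1n mul1r.
suff e0 : `|v i0 0| ^+ 2 = 3^-1 by move: k; apply: forall_ord3; rewrite ?e1 ?e2.
have n3 : (3 : C) != 0 by rewrite pnatr_eq0.
by apply: (mulfI n3); rewrite mulfV // -[RHS]v1 dot3 -!normCKC e1 e2; ring.
Qed.

(** For [b] nonzero the cube root of unity in [mub_vec] is some [w ^+ j], which fixes the label;
    normalization leaves only a phase. *)
Lemma mub_vecP b v : dot v v = 1 -> mub_vec b v ->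
  exists j c, `|c| = 1 /\ v = c *: std b j.
Proof.
move=> v1 mv; have e b0 := mub_entry i0 b0 v1 mv.
move: mv e; rewrite /mub_vec /std; case: (b == 0) => [[j v0] _|].
  exists j, (v j 0); split.
    apply/eqP; rewrite -(@pexpr_eq1 _ _ 2) // normCKC -v1 dotE (bigD1 j) //=.
    by rewrite big1 ?addr0 // => k /v0 ->; rewrite mulr0.
  apply/colP => k; rewrite !mxE; have [->|/v0 ->] := eqVneq k j.
    by rewrite mulr1.
  by rewrite mulr0.
have n3 : (3 : C) != 0 by rewrite pnatr_eq0.
have s3 : sqrtC (3 : C) != 0 by rewrite sqrtC_eq0.
move=> [a [a3 va vb]] e; have [j aj] := cube_rootP a3; rewrite aj in va vb.
exists j, (sqrtC 3 * v i0 0); split.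
  apply/eqP; rewrite -(@pexpr_eq1 _ _ 2) // normrM exprMn e //.
  by rewrite ger0_norm ?sqrtC_ge0 ?ler0n // sqrtCK mulfV.
apply/colP; apply: forall_ord3; rewrite !mxE /= ?va ?vb mulrACA mulfV // mul1r.
- by rewrite !muln0 mulr1.
- by rewrite muln1 muln0 addn0 mulrC.
- by rewrite muln1 exprD exprM; ring.
Qed.

Lemma dot_std b i j : dot (std b i) (std b j) = (i == j)%:R.
Proof.
have n3 : (3 : C) != 0 by rewrite pnatr_eq0.
rewrite /std; case: (b == 0); first by rewrite dot_delta mxE andbT.
rewrite dotZl dotZr mulrA -normCKC.
have -> : `|(sqrtC 3)^-1| ^+ 2 = 3^-1 :> C.
  by have := sqrt3_norm 1; rewrite normr1 expr1n !mulr1.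
rewrite dot3 !mxE /= !muln0 !muln1 addn0 expr0 conjC1 mul1r !addn0.
pose m := (w ^+ i)^* * w ^+ j.
have z : (w ^+ b.-1)^* * w ^+ b.-1 = 1.
  by rewrite cube_root_conj ?w_exp_cube // -exprSr w_exp_cube.
have -> : (w ^+ (i * 2 + b.-1))^* * w ^+ (j * 2 + b.-1) =
    m ^+ 2 * ((w ^+ b.-1)^* * w ^+ b.-1).
  by rewrite !exprD !exprM !rmorphM /= /m; ring.
rewrite z mulr1; have [ij|ij] := eqVneq i j; last first.
  by rewrite /m ratio_sum ?mulr0 //.
rewrite /m -ij cube_root_conj ?w_exp_cube // -exprSr w_exp_cube.
by rewrite expr1n -[RHS]/1%:R; field.
Qed.

(** Such overlaps have modulus 0 or 1. This prevents vectors of two unbiased sets from being of the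
    same kind [b]. *)
Lemma dot_mub_same b u v : dot u u = 1 -> dot v v = 1 ->
  mub_vec b u -> mub_vec b v -> `|dot u v| ^+ 2 != 3^-1.
Proof.
move=> u1 v1 /(mub_vecP u1)[i [c [c1 ->]]] /(mub_vecP v1)[j [d [d1 ->]]].
rewrite dotZl dotZr !normrM norm_conjC c1 d1 !mul1r dot_std.
case: (i == j); rewrite ?normr1 ?normr0 ?expr1n ?expr0n /=.
  by rewrite eq_sym invr_eq1 pnatr_eq1.
by rewrite eq_sym invr_eq0 pnatr_eq0.
Qed.

(** For nonzero indices the overlap is a quadratic Gauss sum: a factor of modulus 1/3 times
    [1 + m + z * m ^+ 2], where [m] is a cube root of unity and [z] a primitive one. *)
Lemma dot_mub_diff b b' u v : (b < 4)%N -> (b' < 4)%N -> b != b' ->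
  dot u u = 1 -> dot v v = 1 ->
  mub_vec b u -> mub_vec b' v -> `|dot u v| ^+ 2 = 3^-1.
Proof.
wlog b'0 : b b' u v / b' != 0.
  move=> W b4 b'4 bb' u1 v1 mu mv; have [b'0|b'0] := eqVneq b' 0; last exact: W mu mv.
  rewrite norm_dotC; apply: W mv mu => //; last by rewrite eq_sym.
  by rewrite -b'0.
move=> b4 b'4 bb' u1 v1 mu mv.
have [b0|b0] := eqVneq b 0.
  move: mu; rewrite /mub_vec b0 eqxx => -[j u0].
  have {}u0 x : dot u x = (u j 0)^* * x j 0.
    by rewrite dotE (bigD1 j) //= big1 ?addr0 // => k /u0 ->; rewrite conjC0 mul0r.
  rewrite u0 normrM exprMn norm_conjC (mub_entry j b'0 v1 mv).
  by rewrite normCKC -u0 u1 mul1r.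
have e := mub_entry i0 b0 u1 mu; have e' := mub_entry i0 b'0 v1 mv.
move: mu mv; rewrite /mub_vec (negPf b0) (negPf b'0).
move=> [a [a3 ua ub]] [a' [a'3 va vb]].
pose m := a^* * a'.
have m3 : m ^+ 3 = 1 by rewrite exprMn -rmorphXn /= a3 a'3 conjC1 mulr1.
pose z := (w ^+ b.-1)^* * w ^+ b'.-1.
have z3 : z ^+ 3 = 1 by exact: ratio_cube.
have zs : 1 + z + z ^+ 2 = 0.
  apply: ratio_sum.
  - by case: b b4 {z z3 bb' b0 ub} => [|[|[|[|]]]].
  - by case: b' b'4 {z z3 bb' b'0 vb} => [|[|[|[|]]]].
  by case: b b' b0 b'0 bb' {z z3 b4 b'4 ub vb} => [|b] [|b'].
have -> : dot u v = (u i0 0)^* * v i0 0 * (1 + m + z * m ^+ 2).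
  by rewrite dot3 ua ub va vb !rmorphM /= /m /z; ring.
clearbody m z.
rewrite !normrM !exprMn norm_conjC e e' normCK !(rmorphD, rmorphM) /= conjC1.
rewrite !cube_root_conj //.
(* The expansion is grouped so that [1 + z + z ^+ 2] and [m ^+ 3 - 1] appear as factors. *)
transitivity (3^-1 * 3^-1 * (1 + m ^+ 3 + z ^+ 3 * (m ^+ 3) ^+ 2 +
   (1 + z + z ^+ 2) * (m + m ^+ 2) + (m ^+ 3 - 1) *
   (z ^+ 2 * m + z ^+ 2 * m ^+ 2 + z * m))); first by ring.
by rewrite m3 z3 zs; field.
Qed.

(** The three numbers form an equilateral triangle centred at 0: their first two elementary
    symmetric functions vanish, so [x ^+ 2 + x * y + y ^+ 2 = 0] and [y / x] is a cube root of
    unity. *)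
Lemma three_phases (x y z : C) :
  `|x| = `|y| -> `|x| = `|z| -> x + y + z = 0 ->
  exists a, [/\ a ^+ 3 = 1, y = a * x & z = a ^+ 2 * x].
Proof.
move=> xy xz s0.
have [x0|x0] := eqVneq x 0.
  exists 1; rewrite x0 normr0 in xy xz; rewrite expr1n x0 !mulr0; split=> //.
    by apply/eqP; rewrite -normr_eq0 -xy.
  by apply/eqP; rewrite -normr_eq0 -xz.
(* Conjugating the relation gives 1/x + 1/y + 1/z = 0. *)
have e2 : x * y + y * z + z * x = 0.
  have c0 : x^* + y^* + z^* = 0 by rewrite -!rmorphD s0 rmorph0.
  have nx : x * x^* = `|x| ^+ 2 by rewrite normCK.
  have ny : y * y^* = `|x| ^+ 2 by rewrite xy normCK.
  have nz : z * z^* = `|x| ^+ 2 by rewrite xz normCK.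
  have n0 : `|x| ^+ 2 != 0 by rewrite sqrf_eq0 normr_eq0.
  apply: (mulfI n0); rewrite mulr0.
  transitivity (x * y * z * (x^* + y^* + z^*)); last by rewrite c0 mulr0.
  transitivity (x * y * (z * z^*) + y * z * (x * x^*) + z * x * (y * y^*)).
    by rewrite nx ny nz; ring.
  by ring.
have E : x ^+ 2 + x * y + y ^+ 2 = 0.
  transitivity ((x + y) * (x + y + z) - (x * y + y * z + z * x)); first by ring.
  by rewrite s0 e2 mulr0 subrr.
have y3 : (y / x) ^+ 3 = 1.
  apply/eqP; rewrite exprMn exprVn -subr_eq0.
  have -> : y ^+ 3 / x ^+ 3 - 1 = (y - x) / x ^+ 3 * (x ^+ 2 + x * y + y ^+ 2) by field.
  by rewrite E mulr0.
exists (y / x); split=> //; first by rewrite divfK.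
have -> : z = - (x + y) by apply/eqP; rewrite -addr_eq0 addrC s0.
apply/eqP; rewrite -subr_eq0.
have -> : - (x + y) - (y / x) ^+ 2 * x = - (x ^+ 2 + x * y + y ^+ 2) / x by field.
by rewrite E oppr0 mul0r.
Qed.

(* Writing p for the cyclic autocorrelation, the two hypotheses give
   p + p^* = 0 and a p + (a p)^* = 0. *)
Lemma autocorrelation0 (v : 'cV[C]_3) a :
  (forall k, `|v k 0| ^+ 2 = 3^-1) -> a ^+ 3 = 1 -> a != 1 ->
  `|v i0 0 + v i1 0 + v i2 0| ^+ 2 = 1 ->
  `|v i0 0 + a^* * v i1 0 + (a ^+ 2)^* * v i2 0| ^+ 2 = 1 ->
  (v i0 0)^* * v i1 0 + (v i1 0)^* * v i2 0 + (v i2 0)^* * v i0 0 = 0.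
Proof.
move=> nv a3 a1; rewrite !normCK !(rmorphD, rmorphM) /= !conjCK.
have := nv i2; have := nv i1; have := nv i0; rewrite !normCK.
rewrite !(cube_root_conj a3).
set x := v i0 0; set y := v i1 0; set z := v i2 0 => nx ny nz.
set p := _^* * y + y^* * z + z^* * x => e1 e2.
pose q := x * y^* + y * z^* + z * x^*.
have n3 : (3 : C) != 0 by rewrite pnatr_eq0.
have pq : p + q = 0.
  rewrite -[RHS](subrr (1 : C)) -{1}e1.
  transitivity ((x + y + z) * (x^* + y^* + z^*) - (x * x^* + y * y^* + z * z^*)).
    by rewrite /p /q; ring.
  by rewrite nx ny nz; congr (_ - _); field.
have apq : a ^+ 2 * p + a * q = 0.
  rewrite -[RHS](subrr (1 : C)) -{1}e2.
  transitivity ((x + a ^+ 2 * y + a ^+ 2 * a ^+ 2 * z) * (x^* + a * y^* + a * a * z^*)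
     - (x * x^* + a ^+ 3 * (y * y^*) + (a ^+ 3) ^+ 2 * (z * z^*))
     - (a ^+ 3 - 1) * (a * z * x^* + a ^+ 2 * z * y^* + a * y * z^*)).
    by rewrite /p /q; ring.
  by rewrite a3 nx ny nz expr1n !mul1r subrr mul0r subr0; congr (_ - _); field.
have a0 : a != 0.
  by apply/eqP => a0; move: a3; rewrite a0 expr0n => /esym/eqP; rewrite oner_eq0.
have : a * (a - 1) * p = 0.
  transitivity (a ^+ 2 * p + a * q - a * (p + q)); first by ring.
  by rewrite pq apq mulr0 subrr.
by move/eqP; rewrite !mulf_eq0 subr_eq0 (negPf a0) (negPf a1) => /eqP.
Qed.

(** The three terms have equal modulus and sum to 0, hence are in the ratios 1, [a], [a ^+ 2]. The
    quotients of cyclically consecutive entries are then [b], [a * b], [a ^+ 2 * b], and their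
    product 1 gives [b ^+ 3 = 1]. The two values of a primitive [a] are the two cases. *)
Lemma mub_vec23 (v : 'cV[C]_3) :
  (forall k, `|v k 0| ^+ 2 = 3^-1) ->
  (v i0 0)^* * v i1 0 + (v i1 0)^* * v i2 0 + (v i2 0)^* * v i0 0 = 0 ->
  mub_vec 2 v \/ mub_vec 3 v.
Proof.
move=> nv p0.
have nE k l : `|v k 0| = `|v l 0|.
  by apply/eqP; rewrite -(@eqrXn2 _ 2) // !nv.
have [||a [a3 E1 E2]] := three_phases _ _ p0;
  try by rewrite !normrM !norm_conjC !(nE _ i0).
have n3 : (3 : C) != 0 by rewrite pnatr_eq0.
have vn0 k : v k 0 != 0 by rewrite -normr_eq0 -sqrf_eq0 nv invr_eq0.
(* This is the quotient of the entries 1 and 0, since the entry 0 has squared modulus 1/3. *)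
pose b := 3 * ((v i0 0)^* * v i1 0).
have v1 : v i1 0 = b * v i0 0.
  rewrite /b -mulrA mulrAC -normCKC nv.
  by rewrite mulrA mulfV // mul1r.
have v2 : v i2 0 = a * b * v i1 0.
  have <- : 3 * ((v i1 0)^* * v i2 0) = a * b by rewrite E1 /b; ring.
  by rewrite -mulrA mulrAC -normCKC nv mulrA mulfV // mul1r.
have v0 : v i0 0 = a ^+ 2 * b * v i2 0.
  have <- : 3 * ((v i2 0)^* * v i0 0) = a ^+ 2 * b by rewrite E2 /b; ring.
  by rewrite -mulrA mulrAC -normCKC nv mulrA mulfV // mul1r.
have b3 : b ^+ 3 = 1.
  apply: (mulIf (vn0 i0)); rewrite mul1r [in RHS]v0 v2 v1.
  rewrite -[LHS]mul1r -a3; ring.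
have a_neq1 : a != 1.
  apply/eqP => a1; move: p0; rewrite E1 E2 a1 expr1n !mul1r.
  rewrite -mulr2n -mulrSr -mulr_natr => /eqP.
  rewrite mulf_eq0 (negPf n3) orbF mulf_eq0 conjC_eq0.
  by rewrite !(negPf (vn0 _)).
have [j aj] := cube_rootP a3; rewrite /mub_vec /=.
have : a = w \/ a = w ^+ 2.
  move: j aj; apply: forall_ord3 => [a1|//|//]; [by rewrite a1 eqxx in a_neq1|..].
    by left.
  by right.
by case=> aw; [left|right]; exists b; split; rewrite // v2 v1 -aw; ring.
Qed.

(** Conjugation inverts [a] and [w ^+ b.-1], which fixes [b = 1] and exchanges 2 and 3; zero entries
    stay zero. *)
Lemma mub_vec_conj b b' v : (b, b') \in [:: (0, 0); (1, 1); (2, 3); (3, 2)]%N ->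
  mub_vec b v -> mub_vec b' (map_mx Num.conj v).
Proof.
rewrite !inE /mub_vec => /or4P[] /eqP[-> ->] /=.
- by move=> [j v0]; exists j => k /v0; rewrite mxE => ->; rewrite conjC0.
all: move=> [a [a3 v1 v2]]; exists a^*; rewrite !mxE v1 v2 !rmorphM /=.
all: split=> //; first by rewrite -rmorphXn a3 rmorph1.
- by rewrite expr0 conjC1.
- by rewrite expr1 (cube_root_conj w_cube).
rewrite (cube_root_conj w_cube) -[w ^+ 1]mul1r -[X in X * w ^+ 1]w_cube; ring.
Qed.

Lemma forall_ord4 (P : 'I_4 -> Prop) :
  (forall (a : 'I_4), a = 0 :> nat -> P a) -> (forall (a : 'I_4), a = 1 :> nat -> P a) ->
  (forall (a : 'I_4), a = 2 :> nat -> P a) -> (forall (a : 'I_4), a = 3 :> nat -> P a) ->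
  forall a, P a.
Proof.
by move=> P0 P1 P2 P3 [] [|[|[|[|//]]]] lt4; [apply: P0|apply: P1|apply: P2|apply: P3].
Qed.

Definition conj_if (e : bool) (v : 'cV[C]_3) : 'cV[C]_3 :=
  if e then map_mx Num.conj v else v.

(** * Four unbiased spanning sets in one factor *)

Section LocalClassification.
Variables (T : finType) (phi : 'I_4 -> T -> 'cV[C]_3).
Hypothesis phi1 : forall a J, dot (phi a J) (phi a J) = 1.
Hypothesis unbiased :
  forall a b J K, a != b -> `|dot (phi a J) (phi b K)| ^+ 2 = 3^-1.
Hypothesis spanning :
  forall a v, (forall J, dot (phi a J) v = 0) -> v = 0.

Let a0 : 'I_4 := @Ordinal 4 0 isT.
Let a1 : 'I_4 := @Ordinal 4 1 isT.
Let a2 : 'I_4 := @Ordinal 4 2 isT.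
Let a3 : 'I_4 := @Ordinal 4 3 isT.

(* The first basis goes to the standard one; the phases left free by this are
   used to send one vector of the second basis to (1, 1, 1) / sqrt 3. *)
Lemma normalizing_unitary : exists U : 'M[C]_3, [/\ U \is unitarymx,
  forall J, mub_vec 0 (U *m phi a0 J),
  forall a J k, a != a0 -> `|(U *m phi a J) k 0| ^+ 2 = 3^-1 &
  exists J0 J1, [/\ forall k, (U *m phi a1 J0) k 0 = (sqrtC 3)^-1,
    dot (U *m phi a1 J0) (U *m phi a1 J1) = 0 &
    forall J, mub_vec 1 (U *m phi a1 J)]].
Proof.
have [t0 [on0 par0]] := orthonormal_triple phi1 unbiased spanning a0.
have [t1 [on1 par1]] := orthonormal_triple phi1 unbiased spanning a1.
have n3 : (3 : C) != 0 by rewrite pnatr_eq0.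
pose p i := dot (phi a0 (t0 i)) (phi a1 (t1 i0)).
have p2 i : `|p i| ^+ 2 = 3^-1 by rewrite unbiased.
have p0 i : p i != 0 by rewrite -normr_eq0 -sqrf_eq0 p2 invr_eq0.
(* These phases turn the coordinates [p i] of the chosen second-basis vector into the constant
   [(sqrtC 3)^-1]. *)
pose z i := (sqrtC 3)^-1 / p i.
have z2 i : `|z i| ^+ 2 = 1.
  by rewrite sqrt3_norm normfV exprVn p2 invrK mulVf.
pose U : 'M[C]_3 := \matrix_(i, k) (z i * (phi a0 (t0 i) k 0)^*).
have UE v i : (U *m v) i 0 = z i * dot (phi a0 (t0 i)) v.
  rewrite mxE dotE mulr_sumr; apply: eq_bigr => k _.
  by rewrite mxE mulrA.
have Uu : U \is unitarymx.
  apply/unitarymxP/matrixP => i j; rewrite mxE [RHS]mxE.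
  transitivity (z i * (z j)^* * dot (phi a0 (t0 i)) (phi a0 (t0 j))).
    rewrite dotE mulr_sumr; apply: eq_bigr => k _.
    by rewrite !mxE rmorphM /= conjCK; ring.
  rewrite on0; have [<-|_] := eqVneq i j; last by rewrite mulr0.
  by rewrite -normCK z2 mul1r.
have U2 a J k : a != a0 -> `|(U *m phi a J) k 0| ^+ 2 = 3^-1.
  by move=> aa0; rewrite UE normrM exprMn z2 mul1r unbiased // eq_sym.
have U1 k : (U *m phi a1 (t1 i0)) k 0 = (sqrtC 3)^-1 by rewrite UE divfK.
exists U; split=> // [J|].
  have [i [c ->]] := par0 J; exists i => k ki.
  by rewrite UE dotZr on0 (negPf ki) !mulr0.
exists (t1 i0), (t1 i1); split=> // [|J]; first by rewrite dot_unitary // on1.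
have [i [c ->]] := par1 J; rewrite -scalemxAr; apply: mub_vecZ.
have [->|ii0] := eqVneq i i0.
  by exists 1; rewrite !U1 !expr1n expr0 !mul1r.
have nE k l : `|(U *m phi a1 (t1 i)) k 0| = `|(U *m phi a1 (t1 i)) l 0|.
  by apply/eqP; rewrite -(@eqrXn2 _ 2) // !U2.
have s0 : (sqrtC 3)^-1 != 0 :> C by rewrite invr_eq0 sqrtC_eq0.
(* Orthogonality to the constant vector makes the entries, which have equal modulus, sum to 0. *)
have sum0 : (U *m phi a1 (t1 i)) i0 0 + (U *m phi a1 (t1 i)) i1 0 +
    (U *m phi a1 (t1 i)) i2 0 = 0.
  have := on1 i0 i; rewrite eq_sym (negPf ii0) -(dot_unitary _ _ Uu) dot3 !U1.
  by rewrite -!mulrDr => /eqP; rewrite mulf_eq0 conjC_eq0 (negPf s0) => /eqP.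
have [a [ac E1 E2]] := three_phases (nE i0 i1) (nE i0 i2) sum0.
by exists a; rewrite expr0 mul1r.
Qed.

(** After normalization the last two sets contain only vectors of kinds 2 and 3, and never the same
    kind in both sets. Either the order is right or one conjugation corrects it. *)
Lemma local_classification : exists (U : 'M[C]_3) (e : bool),
  U \is unitarymx /\ forall (a : 'I_4) J, mub_vec a (conj_if e (U *m phi a J)).
Proof.
have [U [Uu m0 nv [J0 [J1 [s01 o01 m1]]]]] := normalizing_unitary.
pose h a J := U *m phi a J.
have h1 a J : dot (h a J) (h a J) = 1 by rewrite dot_unitary.
have hu a b J K : a != b -> `|dot (h a J) (h b K)| ^+ 2 = 3^-1.
  by move=> ab; rewrite dot_unitary // unbiased.
have n3 : (3 : C) != 0 by rewrite pnatr_eq0.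
have s0 : (sqrtC 3)^-1 != 0 :> C by rewrite invr_eq0 sqrtC_eq0.
have s2 (x : C) : `|(sqrtC 3)^-1 * x| ^+ 2 = 3^-1 -> `|x| ^+ 2 = 1.
  by move=> H; apply: (mulfI (invr_neq0 n3)); rewrite -sqrt3_norm H mulr1.
have sr : ((sqrtC 3)^-1)^* = (sqrtC 3)^-1 :> C.
  by rewrite conj_Creal // rpredV ger0_real // sqrtC_ge0 ler0n.
(* Unbiasedness to the constant vector [J0] and to the vector [J1], proportional to [(1, b, b^2)],
   supplies the two equations for the autocorrelation; [b] is not 1 because [J0] and [J1] are
   orthogonal. *)
have h23 (a : 'I_4) J : (1 < a)%N -> mub_vec 2 (h a J) \/ mub_vec 3 (h a J).
  move=> a_gt1.
  have aa0 : a != a0 by apply: contraTneq a_gt1 => ->.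
  have a1a : a1 != a by apply: contraTneq a_gt1 => <-.
  have nh k : `|h a J k 0| ^+ 2 = 3^-1 by apply: nv.
  apply: mub_vec23 => //.
  have [b [b3 E1 E2]] := m1 J1; rewrite expr0 mul1r in E2.
  set y := (U *m phi a1 J1) i0 0 in E1 E2.
  have y2 : `|y| ^+ 2 = 3^-1 by apply: nv.
  apply: (@autocorrelation0 _ b) => //.
  - apply/eqP => b1; move/eqP: o01; rewrite dot3 !s01 E1 E2 b1 expr1n !mul1r -/y.
    rewrite -!mulrDr mulf_eq0 conjC_eq0 (negPf s0) /= -mulr2n -mulrSr.
    rewrite -mulr_natr mulf_eq0 (negPf n3) orbF -normr_eq0 -sqrf_eq0 y2.
    by rewrite invr_eq0 (negPf n3).
  - by apply: s2; rewrite -(hu _ _ J0 J a1a) dot3 !s01 sr !mulrDr.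
  apply: (mulfI (invr_neq0 n3)); rewrite mulr1 -[RHS](hu _ _ J1 J a1a).
  rewrite -y2 -[`|y|]norm_conjC -exprMn -normrM dot3 E1 E2 -/y; congr (`|_| ^+ 2).
  by rewrite !rmorphM /=; ring.
have notsame b (a a' : 'I_4) J K :
    a != a' -> mub_vec b (h a J) -> mub_vec b (h a' K) -> False.
  by move=> aa' ma ma'; have := dot_mub_same (h1 a J) (h1 a' K) ma ma'; rewrite hu ?eqxx.
have opposite b c (a a' : 'I_4) J : (1 < a')%N -> a != a' ->
    (b, c) \in [:: (2, 3); (3, 2)]%N -> mub_vec b (h a J) -> forall K, mub_vec c (h a' K).
  move=> a'_gt1 aa'; rewrite !inE => /orP[] /eqP[-> ->] ma K.
    by have [/(notsame _ _ _ _ _ aa' ma)|] := h23 a' K a'_gt1.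
  by have [|/(notsame _ _ _ _ _ aa' ma)] := h23 a' K a'_gt1.
(* The label [J0] only serves as a sample: the kind of one vector decides the other set, which in
   turn decides the first. *)
exists U; have [m2|m3] := h23 a2 J0 isT.
  have {}m3 : forall K, mub_vec 3 (h a3 K) by apply: opposite m2.
  have {}m2 : forall K, mub_vec 2 (h a2 K) by apply: opposite (m3 J0).
  exists false; split=> // a J; move: a; apply: forall_ord4 => a aE; rewrite aE /=.
  - by rewrite (_ : a = a0) //; apply: val_inj.
  - by rewrite (_ : a = a1) //; apply: val_inj.
  - by rewrite (_ : a = a2); [exact: m2 | apply: val_inj].
  - by rewrite (_ : a = a3); [exact: m3 | apply: val_inj].
have {}m2 : forall K, mub_vec 2 (h a3 K) by apply: opposite m3.
have {}m3 : forall K, mub_vec 3 (h a2 K) by apply: opposite (m2 J0).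
exists true; split=> // a J; move: a; apply: forall_ord4 => a aE; rewrite aE /=.
- by rewrite (_ : a = a0); [apply: mub_vec_conj (m0 J) | apply: val_inj].
- by rewrite (_ : a = a1); [apply: mub_vec_conj (m1 J) | apply: val_inj].
- by rewrite (_ : a = a2); [apply: mub_vec_conj (m3 J) | apply: val_inj].
- by rewrite (_ : a = a3); [apply: mub_vec_conj (m2 J) | apply: val_inj].
Qed.

End LocalClassification.

End Standard.

(** * Classification of quadruples *)

Section LocalEquivalence.
Variables (C : numClosedFieldType) (n q m : nat).
Implicit Types B : basis_family C n q m.

(** Trivial phases supply reflexivity, in a pointwise form. *)
Lemma local_equiv_eq B B' : (forall a J, B' a J = B a J) -> local_equiv B B'.
Proof.
move=> E; apply: (LE_phase (c := fun _ _ => 1)) => [a J|a J k].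
  by rewrite normr1.
by rewrite E mul1r.
Qed.

(** One factor is conjugated at a time, along a fixed factorization; uniqueness in [s] keeps a
    factor from being conjugated twice. *)
Lemma local_equiv_conj_seq B B' psi (s : seq 'I_n) : uniq s ->
  (forall a J, B a J = tensor (psi a J)) ->
  (forall a J, B' a J = tensor (fun r =>
     if r \in s then map_mx Num.conj (psi a J r) else psi a J r)) ->
  local_equiv B B'.
Proof.
elim: s B' => [|r s IHs] B' /= => [_|/andP[rs us]] EB EB'.
  by apply: local_equiv_eq => a J; rewrite EB EB'; apply: eq_tensor.
pose psi1 a J t := if t \in s then map_mx Num.conj (psi a J t) else psi a J t.
apply: (@LE_trans _ _ _ _ _ (fun a J => tensor (psi1 a J))); first exact: IHs.
apply: (@LE_conj _ _ _ _ _ _ r psi1) => // a J.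
rewrite EB'; apply: eq_tensor => t; rewrite inE /psi1.
by have [->|_] := eqVneq t r; rewrite ?(negPf rs).
Qed.

End LocalEquivalence.

Section Classification.
Variables (C : numClosedFieldType) (w : C).
Hypothesis w_sum : 1 + w + w ^+ 2 = 0.
Variable n : nat.
Variable e : 'I_4 -> 'I_n -> 'I_3 -> 'cV[C]_3.
Hypothesis e_on : forall b r J K, dot (e b r J) (e b r K) = (J == K)%:R.
Hypothesis e_mub : forall (b : 'I_4) r J, mub_vec w b (e b r J).

Lemma tensor_basis_on b J K :
  braket (tensor_basis (e b) J) (tensor_basis (e b) K) = (J == K)%:R.
Proof.
rewrite braket_tensor; under eq_bigr do rewrite e_on.
have [->|JK] := eqVneq J K; first by rewrite big1 // => r _; rewrite eqxx.
have [r /negPf Jr] : exists r, J r != K r.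
  apply/existsP; apply: contraNT JK => /existsPn JK.
  by apply/eqP/ffunP => r; apply/eqP; rewrite -[_ == _]negbK JK.
by rewrite (bigD1 r) //= Jr mul0r.
Qed.

Lemma standard_mu_product_bases :
  mu_product_bases (fun b => tensor_basis (e b)).
Proof.
split=> [b|b c bc J K].
  split; first by apply: orthonormal_basisP; exact: tensor_basis_on.
  by move=> J; exists (fun r => e b r (J r)).
rewrite braket_tensor normr_prod -prodrXl card_ffun !card_ord natrX.
under eq_bigr => r _ do
  rewrite (dot_mub_diff w_sum (ltn_ord b) (ltn_ord c) bc) ?e_on ?eqxx //.
by rewrite prodr_const card_ord exprVn.
Qed.

(** Any eigenbases agree with [std] up to phases and relabelling. The relabelling is injective
    because equal labels would give overlap of modulus 1. *)
Lemma standard_form : exists (tau : 'I_4 -> 'I_n -> 'I_3 -> 'I_3)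
    (c : 'I_4 -> 'I_n -> 'I_3 -> C), forall b r,
  injective (tau b r) /\
  forall J, `|c b r J| = 1 /\ e b r J = c b r J *: std w b (tau b r J).
Proof.
have tau_ex b r J : exists j c, `|c| = 1 /\ e b r J = c *: std w b j.
  by apply: (mub_vecP w_sum) => //; rewrite e_on eqxx.
have /fin_all_exists[tau tauP] b := fin_all_exists (fun r => fin_all_exists (tau_ex b r)).
have /fin_all_exists[c cP] b := fin_all_exists (fun r => fin_all_exists (tauP b r)).
exists tau, c => b r; split=> // J K EJK.
have := e_on b r J K; rewrite (cP b r J).2 (cP b r K).2 EJK dotZl dotZr.
rewrite (dot_std w_sum) eqxx mulr1 => /(congr1 Num.norm).
rewrite normrM norm_conjC (cP b r J).1 (cP b r K).1 mul1r.
have [//|_] := eqVneq J K; rewrite normr0 => /eqP; by rewrite oner_eq0.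
Qed.

(** Local unitaries, then conjugation of selected factors, bring all vectors to products of [std]
    vectors up to phases; a permutation and phases match these with [e]. *)
Lemma mu_product_bases_equiv (B : basis_family C n 3 4) :
  mu_product_bases B -> local_equiv B (fun b => tensor_basis (e b)).
Proof.
move=> [Bprod Bmu].
have /fin_all_exists[psi psiP] a := product_basis_factors (Bprod a).
have psi1 a J r : dot (psi a J r) (psi a J r) = 1 by apply: (psiP a).2.
have BE a J : B a J = tensor (psi a J) by apply: (psiP a).1.
have /fin_all_exists[U /fin_all_exists[k Ukp]] r :
    exists (U : 'M[C]_3) (k : bool), U \is unitarymx /\
      forall (a : 'I_4) J, mub_vec w a (conj_if k (U *m psi a J r)).
  apply: (local_classification w_sum (phi := fun a J => psi a J r)) => [//||].
    by move=> a b J K ab; exact: unbiased_factors (Bprod a) (psiP a) (psiP b) (Bmu a b ab) _ _ _.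
  by move=> a v; exact: factors_spanning (Bprod a) (psiP a).
have Uu r : U r \is unitarymx by case: (Ukp r).
pose chi a J r := conj_if (k r) (U r *m psi a J r).
have chi_dot a J K r : `|dot (chi a J r) (chi a K r)| = `|dot (psi a J r) (psi a K r)|.
  rewrite /chi /conj_if; case: (k r); rewrite ?dot_conj ?norm_conjC dot_unitary //.
have chi1 a J r : dot (chi a J r) (chi a J r) = 1.
  rewrite /chi /conj_if; case: (k r); rewrite ?dot_conj dot_unitary // psi1 //.
  exact: conjC1.
have step1 : local_equiv B (fun a J => tensor (chi a J)).
  apply: (@LE_trans _ _ _ _ _ (fun a J => tensor (fun r => U r *m psi a J r))).
    by apply: (LE_unitary (U := U)) => // a J; rewrite BE tensor_op_tensor.
  apply: (@local_equiv_conj_seq _ _ _ _ _ _ (fun a J r => U r *m psi a J r)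
            (enum (fun r => k r))) => //; first exact: enum_uniq.
  move=> a J; apply: eq_tensor => r; rewrite mem_enum /chi /conj_if.
  by rewrite unfold_in.
have /fin_all_exists[sig /fin_all_exists[d sigP]] a :
    exists (s : multi_index n 3 -> multi_index n 3)
           (d : multi_index n 3 -> 'I_n -> C), forall J r,
    `|d J r| = 1 /\ chi a J r = d J r *: std w a (s J r).
  have /fin_all_exists[s /fin_all_exists[d dP]] J :
      exists (s : multi_index n 3) (d : 'I_n -> C), forall r,
      `|d r| = 1 /\ chi a J r = d r *: std w a (s r).
    have /fin_all_exists[s /fin_all_exists[d dP]] r : exists j c,
        `|c| = 1 /\ chi a J r = c *: std w a j.
      by apply: (mub_vecP w_sum) => //; exact: (Ukp r).2.
    by exists (finfun s), d => r; rewrite ffunE.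
  by exists s, d.
have sig_inj a : injective (sig a).
  move=> J K E; apply/eqP; apply: contraT => /negPf JK.
  have [[on _] _] := Bprod a; have := on J K.
  rewrite !BE braket_tensor JK => /(congr1 Num.norm)/eqP.
  rewrite normr_prod normr0 big1 ?oner_eq0 // => r _.
  rewrite -chi_dot (sigP a J r).2 (sigP a K r).2 E dotZl dotZr !normrM norm_conjC.
  by rewrite (sigP a J r).1 (sigP a K r).1 (dot_std w_sum) eqxx normr1 !mulr1.
have [tau [c tauP]] := standard_form.
pose tauf a (J : multi_index n 3) : multi_index n 3 := [ffun r => tau a r (J r)].
have tau_inj a : injective (tauf a).
  move=> J K /ffunP E; apply/ffunP => r; apply: (tauP a r).1.
  by have := E r; rewrite !ffunE.
(* The place [J] receives the vector of the [a]-th basis whose [std] label is that of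
   [tensor_basis (e a) J]; [sig a] is invertible, being injective on a finite type. *)
have perm_inj a : injective (fun J => invF (@sig_inj a) (tauf a J)).
  by move=> J K /(can_inj (f_invF (@sig_inj a)))/tau_inj.
pose s a := perm (@perm_inj a).
have sE a J : sig a (s a J) = tauf a J by rewrite permE f_invF.
apply: (LE_trans step1).
apply: (@LE_trans _ _ _ _ _ (fun a J => tensor (chi a (s a J)))).
  exact: LE_permute_vectors.
pose z a (J : multi_index n 3) := \prod_r (c a r (J r) / d a (s a J) r).
apply: (LE_phase (c := z)) => [a J|a J x].
  rewrite normr_prod big1 // => r _.
  by rewrite normrM normfV (sigP a _ r).1 ((tauP a r).2 _).1 invr1 mulr1.
rewrite -tensorZ /tensor_basis; congr (fun_of_fin _ _); apply: eq_tensor => r.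
rewrite ((tauP a r).2 _).2 (sigP a _ r).2 sE ffunE scalerA divfK //.
by rewrite -normr_eq0 (sigP a _ r).1 oner_eq0.
Qed.

End Classification.

(** * Eigenbases of the Weyl operators *)

Section Weyl.
Variable R : realType.
Notation w := (omega R).

(** With [t = 2 * pi / 3], comparing [sin (2 * t)] with [sin (2 * pi - t)] gives [cos t = - 2^-1],
    as [sin t] is positive. *)
Lemma omega_sum : 1 + w + w ^+ 2 = 0.
Proof.
pose t : R := 2 * pi / 3; pose c := cos t; pose s := sin t.
have t0 : 0 < t < pi.
  by have := pi_gt0 R; rewrite /t => p0; apply/andP; split; lra.
have s0 : s != 0 by rewrite gt_eqF // sin_gt0_pi.
have sc : s * (2 * c + 1) = 0.
  have := sin_mulr2n t; have -> : t *+ 2 = pi *+ 2 - t by rewrite /t; field.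
  rewrite sinB sin2pi cos2pi -/s -/c mul0r mul1r sub0r => E.
  by transitivity (c * s *+ 2 + s); [ring | rewrite -E addNr].
have c2 : c = - 2^-1.
  move/eqP: sc; rewrite mulf_eq0 (negPf s0) /= => /eqP; lra.
have s2 : s ^+ 2 = 3 / 4.
  have := cos2Dsin2 t; rewrite -/c -/s c2 => E.
  by rewrite -[LHS](addKr ((- 2^-1) ^+ 2)) E; field.
apply/eqP; rewrite eq_complex /= -/t -/c -/s; apply/andP; split; apply/eqP.
  by rewrite -[s * s]expr2 s2 c2; field.
by rewrite c2; field.
Qed.

Lemma phaseZ_mul (v : 'cV[R[i]]_3) k : (phaseZ R *m v) k 0 = w ^+ k * v k 0.
Proof.
rewrite mxE (bigD1 k) //= big1 ?addr0 => [|j /negPf jk]; rewrite mxE.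
  by rewrite eqxx mulr1n.
by rewrite eq_sym jk mulr0n mul0r.
Qed.

Lemma shiftX_mul (v : 'cV[R[i]]_3) k : (shiftX R *m v) (ordS k) 0 = v k 0.
Proof.
rewrite mxE (bigD1 k) //= big1 ?addr0 => [|j /negPf jk]; rewrite mxE.
  by rewrite eqxx mul1r.
by rewrite (inj_eq (@ordS_inj _)) eq_sym jk mul0r.
Qed.

Lemma weyl_mul (b : 'I_4) (v : 'cV[R[i]]_3) k : (b : nat) != 0%N ->
  (weyl R b *m v) (ordS k) 0 = (w ^+ b.-1) ^+ k * v k 0.
Proof.
move: b; apply: forall_ord4 => b; rewrite /weyl => -> //= _.
- by rewrite shiftX_mul expr1n mul1r.
- by rewrite -mulmxA shiftX_mul phaseZ_mul expr1.
by rewrite -!mulmxA shiftX_mul !phaseZ_mul mulrA -exprMn -expr2.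
Qed.

Lemma forall_ordS3 (P : 'I_3 -> Prop) : (forall k, P (ordS k)) -> forall k, P k.
Proof. by move=> H k; rewrite -(ord_predK k). Qed.

(** For [b] nonzero the shift moves the entry 0 to the place of the entry 1, [a] times as large, so
    the eigenvalue is the inverse of [a], that is [a ^+ 2]. *)
Lemma mub_vec_eigen (b : 'I_4) v : mub_vec w b v ->
  exists l : R[i], weyl R b *m v = l *: v.
Proof.
have [b0|b0] := eqVneq (b : nat) 0%N; rewrite /mub_vec.
  rewrite b0 => -[j vj]; exists (w ^+ j); apply/colP => k.
  rewrite /weyl b0 phaseZ_mul mxE.
  by have [->//|/vj ->] := eqVneq k j; rewrite !mulr0.
rewrite (negPf b0) => -[a [a3 v1 v2]]; exists (a ^+ 2); apply/colP.
have z3 : (w ^+ b.-1) ^+ 3 = 1 := w_exp_cube omega_sum _.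
apply: forall_ordS3 => k; rewrite weyl_mul // mxE; move: k.
have s0 : ordS i0 = i1 by apply: val_inj.
have s1 : ordS i1 = i2 by apply: val_inj.
have s2 : ordS i2 = i0 by apply: val_inj.
apply: forall_ord3; rewrite ?s0 ?s1 ?s2 ?v1 ?v2 /=.
- by rewrite expr0 mul1r mulrA -exprSr a3 mul1r.
- rewrite expr1; transitivity (a ^+ 3 * (w ^+ b.-1 * a * v i0 0)); last by ring.
  by rewrite a3; ring.
transitivity ((w ^+ b.-1) ^+ 3 * (a ^+ 2 * v i0 0)); first by ring.
by rewrite z3 mul1r.
Qed.

(** For [b = 0] the diagonal entries of [Z] are distinct, so one entry of [v] survives. Otherwise
    the three entry equations, composed round the cycle, give [l ^+ 3 = z ^+ 3 = 1], and the cube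
    root sought is the inverse of [l]. *)
Lemma eigen_mub_vec (b : 'I_4) v (l : R[i]) : dot v v = 1 ->
  weyl R b *m v = l *: v -> mub_vec w b v.
Proof.
move=> vv E.
have v_neq0 : exists j, v j 0 != 0.
  apply/existsP; apply: contraT => /existsPn v0.
  move: vv; rewrite dotE big1 => [/esym/eqP|k _]; first by rewrite oner_eq0.
  by have := v0 k; rewrite negbK => /eqP ->; rewrite mulr0.
have {}E k : (weyl R b *m v) k 0 = l * v k 0 by rewrite E mxE.
rewrite /mub_vec; have [b0|b0] := eqVneq (b : nat) 0%N.
  have [j vj] := v_neq0; exists j => k kj; apply/eqP.
  have Z (i : 'I_3) : w ^+ i * v i 0 = l * v i 0 by rewrite -E /weyl b0 phaseZ_mul.
  have lj : l = w ^+ j by apply: (mulIf vj); rewrite -Z.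
  apply: contraNT kj => vk; apply/eqP/val_inj.
  apply: (w_exp_inj omega_sum) => //=.
  by apply: (mulIf vk); rewrite Z lj.
set z := w ^+ b.-1; have z3 : z ^+ 3 = 1 := w_exp_cube omega_sum _.
have e0 : l * v i1 0 = v i0 0.
  have <- : ordS i0 = i1 by apply: val_inj.
  by rewrite -E weyl_mul // mul1r.
have e1 : l * v i2 0 = z * v i1 0.
  have <- : ordS i1 = i2 by apply: val_inj.
  by rewrite -E weyl_mul.
have e2 : l * v i0 0 = z ^+ 2 * v i2 0.
  have <- : ordS i2 = i0 by apply: val_inj.
  by rewrite -E weyl_mul.
have l3 k : (l ^+ 3 - 1) * v k 0 = 0.
  move: k; apply: forall_ord3.
  - transitivity (l ^+ 2 * (l * v i0 0) - v i0 0); first by ring.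
    rewrite e2; transitivity (l * z ^+ 2 * (l * v i2 0) - v i0 0); first by ring.
    rewrite e1; transitivity (z ^+ 3 * (l * v i1 0) - v i0 0); first by ring.
    by rewrite z3 e0 mul1r subrr.
  - transitivity (l ^+ 2 * (l * v i1 0) - v i1 0); first by ring.
    rewrite e0; transitivity (l * (l * v i0 0) - v i1 0); first by ring.
    rewrite e2; transitivity (z ^+ 2 * (l * v i2 0) - v i1 0); first by ring.
    rewrite e1; transitivity (z ^+ 3 * v i1 0 - v i1 0); first by ring.
    by rewrite z3 mul1r subrr.
  transitivity (l ^+ 2 * (l * v i2 0) - v i2 0); first by ring.
  rewrite e1; transitivity (l * z * (l * v i1 0) - v i2 0); first by ring.
  rewrite e0; transitivity (z * (l * v i0 0) - v i2 0); first by ring.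
  rewrite e2; transitivity (z ^+ 3 * v i2 0 - v i2 0); first by ring.
  by rewrite z3 mul1r subrr.
have {}l3 : l ^+ 3 = 1.
  have [j vj] := v_neq0; apply/eqP; rewrite -subr_eq0.
  by have /eqP := l3 j; rewrite mulf_eq0 (negPf vj) orbF.
exists (l ^+ 2); split.
- by rewrite exprAC l3 expr1n.
- by rewrite -e0 mulrA -exprSr l3 mul1r.
rewrite -/z -e0 -[LHS]mul1r -l3.
transitivity (l ^+ 2 * (l * v i2 0)); first by ring.
rewrite e1; transitivity (l ^+ 3 * (z * l ^+ 2 * v i1 0)); last by ring.
by rewrite l3; ring.
Qed.

End Weyl.

Theorem corollary2 (R : realType) (n : nat) (hn : (1 <= n)%N) :
  (exists e : 'I_4 -> 'I_n -> 'I_3 -> 'cV[R[i]]_3,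
     forall b r, eigenbasis (weyl R b) (e b r)) /\
  (forall e : 'I_4 -> 'I_n -> 'I_3 -> 'cV[R[i]]_3,
     (forall b r, eigenbasis (weyl R b) (e b r)) ->
     mu_product_bases (fun b => tensor_basis (e b)) /\
     (forall B : basis_family R[i] n 3 4,
        mu_product_bases B ->
        local_equiv B (fun b => tensor_basis (e b)))).
Proof.
split=> [|e eE].
  (* The same explicit eigenvectors are taken in every factor. *)
  exists (fun b r J => std (omega R) b J) => b r; split.
    by apply: orthonormal_basisP => J K; apply: dot_std; apply: omega_sum.
  by move=> J; apply: mub_vec_eigen; apply: mub_std; apply: omega_sum.
have e_on b r J K : dot (e b r J) (e b r K) = (J == K)%:R.
  by have [[on _] _] := eE b r; apply: on.
have e_mub (b : 'I_4) r J : mub_vec (omega R) b (e b r J).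
  have [_ eig] := eE b r; have [l lE] := eig J.
  by apply: eigen_mub_vec lE; rewrite e_on eqxx.
split; first exact (standard_mu_product_bases (omega_sum R) e_on e_mub).
exact (mu_product_bases_equiv (omega_sum R) e_on e_mub).
Qed.
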